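(* For every $D, n \in \mathbb{N}$ and every $d \in \mathbb{Q}$ with $d > 1$, there exists a graph $G$ with $$ e(G) \le n^{2 - 1/d} \cdot 2^{C \sqrt{\log n}} $$ edges which is $\mathcal{H}_d^D(n)$-universal, where $C = C(D, d)$ is a constant depending only on $D$ and $d$.
   Context: All graphs are finite and simple. For a graph $H$, its density is $m(H) = \max_{H' \subseteq H} e(H')/v(H')$, where $e(\cdot)$ and $v(\cdot)$ denote numbers of edges and vertices. For $d \in \mathbb{Q}$ and $n, D \in \mathbb{N}$, $\mathcal{H}_d(n)$ is the family of all graphs on $n$ vertices with density at most $d$, and $\mathcal{H}_d^D(n)$ is the family of all $H \in \mathcal{H}_d(n)$ with maximum degree at most $D$. A graph $G$ is universal for a family $\mathcal{H}$ (or $\mathcal{H}$-universal) if every $H \in \mathcal{H}$ is a (not necessarily induced) subgraph of $G$. *)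

(* Defs.v *)
From HB Require Import structures.
From mathcomp Require Import all_boot all_order all_algebra.

Set Implicit Arguments.
Unset Strict Implicit.
Unset Printing Implicit Defensive.

Import Order.TTheory GRing.Theory Num.Theory.

Record sgraph := SGraph {
  svertex :> finType;
  sedge : rel svertex;
  sedge_sym : symmetric sedge;
  sedge_irrefl : irreflexive sedge }.

Definition edges (G : sgraph) : {set {set G}} :=
  [set e | [exists x, exists y, sedge x y && (e == [set x; y])]].

Definition degree (G : sgraph) (x : G) : nat := #|[set y | sedge x y]|.

Definition max_degree (G : sgraph) : nat := \max_(x : G) degree x.

(* A subgraph of G is given by a vertex set S.1 and an edge set S.2; it need
   not be induced. *)
Definition is_subgraph (G : sgraph) (S : {set G} * {set {set G}}) : bool :=
  (S.2 \subset edges G) && [forall e in S.2, e \subset S.1].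

(* The maximum ranges over the subgraphs with at least one vertex; all ratios
   are nonnegative, so the default value 0 only matters for the graph with no
   vertices, whose density is 0. *)
Definition density (G : sgraph) : rat :=
  \big[Num.max/0%R]_(S : {set G} * {set {set G}} |
      is_subgraph S && (S.1 != set0))
    (#|S.2|%:R / #|S.1|%:R)%R.

Definition density_family (d : rat) (n : nat) (H : sgraph) : Prop :=
  #|H| = n /\ (density H <= d)%R.

Definition bounded_density_family (D : nat) (d : rat) (n : nat)
    (H : sgraph) : Prop :=
  density_family d n H /\ max_degree H <= D.

(* H is isomorphic to a not necessarily induced subgraph of G. *)
Definition contained_in (H G : sgraph) : Prop :=
  exists2 f : H -> G, injective f & {homo f : x y / sedge x y}.

Definition universal (F : sgraph -> Prop) (G : sgraph) : Prop :=
  forall H : sgraph, F H -> contained_in H G.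

(* Main.v *)
Require Import Defs.
From HB Require Import structures.
From mathcomp Require Import all_boot all_order all_algebra.
From mathcomp Require Import perm.
From mathcomp Require Import all_classical all_reals all_analysis.
From mathcomp Require Import fintype finset.
From mathcomp Require Import zify ring lra.

(* Write d = a/b. Giving each edge of H multiplicity b, the density bound lets
   one orient all copies with out-degree at most a (Hall), and colour them with
   a colours so that neither two copies leaving one vertex nor two copies of one
   edge agree (Koenig). This gives partial functions p_i : H -> H such that
   each edge is a step of p_i for at least b of the indices i.

   Let q = 2^l with l ~ sqrt(log n) and q^(a l) slightly larger than n. Label
   the vertices in each colour by letters of [q] and send v to the a words
   f_i(v) = (r_i(v), r_i(p_i v), r_i(p_i^2 v), ...) of length l. Along p_i a
   word is shifted by one letter, as in a de Bruijn graph. The host graph has as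
   vertices the a-tuples of words, two being joined when at least b coordinates
   are equal or shifts of one another; it has about n^(2 - b/a) edges up to
   factors q^O(1). Short cycles of p_i are contracted, so that every f_i(v) reads
   distinct labels; since H has bounded degree, only 2^O(l) vertices share labels
   with a given one, hence for a suitable labelling all fibres of v |-> f(v)
   have size 2^O(l), which a blow-up of the host absorbs. *)

Set Implicit Arguments.
Unset Strict Implicit.
Unset Printing Implicit Defensive.

Import Order.TTheory GRing.Theory Num.Theory.

(** * Systems of representatives with capacities *)

(* Rado: in a minimal family satisfying the condition every set is a singleton.
   If removing [x] and removing [y] from the same [S e] both broke it, on [F1]
   and [F2], submodularity of [F |-> #|\bigcup_(f in F) S f|] would break the
   condition for [F1 :|: F2] or [(F1 :&: F2) :\ e]. *)
Lemma capacitated_hall (E V : finType) (c : nat) (S : {ffun E -> {set V}}) :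
  (forall F : {set E}, #|F| <= c * #|\bigcup_(e in F) S e|) ->
  exists g : E -> V, (forall e, g e \in S e) /\
    forall v, #|[set e | g e == v]| <= c.
Proof.
have [m] := ubnP (\sum_e #|S e|); elim: m S => // m IHm S le_m hallS.
have nonempty e : 0 < #|S e|.
  have := hallS [set e]; rewrite big_set1 cards1.
  by case: #|S e| => //; rewrite muln0.
have [small | /forallPn[e]] := boolP [forall e, #|S e| <= 1]; last first.
  rewrite -ltnNge => /card_gt1P[x [y [xS yS neq_xy]]].
  pose rem z : {ffun E -> {set V}} := [ffun f => if f == e then S f :\ z else S f].
  have shrink z : z \in S e ->
      (forall F : {set E}, #|F| <= c * #|\bigcup_(f in F) rem z f|) ->
      exists g : E -> V, (forall e, g e \in S e) /\
        forall v, #|[set e | g e == v]| <= c.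
    move=> zS hallR.
    have [|g [gR gc]] := IHm (rem z) _ hallR.
      rewrite ltnS in le_m; apply: leq_trans le_m.
      rewrite (bigD1 e) //= [leqRHS](bigD1 e) //= ffunE eqxx.
      rewrite (cardsD1 z (S e)) zS add1n addSn ltnS leq_add2l.
      by apply: leq_sum => f ne; rewrite ffunE (negPf ne).
    exists g; split=> // f; have := gR f; rewrite ffunE.
    by case: eqP => // _; rewrite inE => /andP[].
  (* A set avoiding [e] does not notice the removal, so a violating set contains [e]. *)
  have violated z : (exists2 F : {set E}, e \in F &
      c * #|\bigcup_(f in F) rem z f| < #|F|) \/
      (forall F : {set E}, #|F| <= c * #|\bigcup_(f in F) rem z f|).
    have [/forallP ? | /forallPn[F]] :=
      boolP [forall F : {set E}, #|F| <= c * #|\bigcup_(f in F) rem z f|]; [by right|].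
    rewrite -ltnNge => ltF; left; exists F => //; apply/negPn/negP => eF.
    move: ltF; rewrite ltnNge => /negP; apply; apply: leq_trans (hallS F) _.
    rewrite [X in _ <= c * #|pred_of_set X|](eq_bigr S) // => f fF.
    by rewrite ffunE; case: eqP => // fe; rewrite fe (negPf eF) in fF.
  have [[F1 e1 lt1] | ] := violated x; last exact: shrink.
  have [[F2 e2 lt2] | ] := violated y; last exact: shrink.
  set N1 := \bigcup_(f in F1) _ in lt1; set N2 := \bigcup_(f in F2) _ in lt2.
  have subU : \bigcup_(f in F1 :|: F2) S f \subset N1 :|: N2.
    apply/bigcupsP => f; rewrite !inE => fF; apply/subsetP => z zS.
    rewrite inE; have [fe | fe] := eqVneq f e.
      have [zx | zx] := eqVneq z x; apply/orP.
        right; apply/bigcupP; exists e => //; rewrite ffunE eqxx !inE -fe zS.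
        by rewrite zx neq_xy.
      by left; apply/bigcupP; exists e => //; rewrite ffunE eqxx !inE -fe zS zx.
    case/orP: fF => fF; apply/orP; [left | right]; apply/bigcupP; exists f => //;
      by rewrite ffunE (negPf fe).
  have subI : \bigcup_(f in (F1 :&: F2) :\ e) S f \subset N1 :&: N2.
    apply/bigcupsP => f; rewrite !inE => /and3P[fe f1 f2]; apply/subsetP => z zS.
    by rewrite inE; apply/andP; split; apply/bigcupP; exists f => //;
      rewrite ffunE (negPf fe).
  (* The two strict bounds give a surplus of two; dropping [e] from the intersection costs only
     one. *)
  have := leq_trans (hallS _) (leq_mul (leqnn c) (subset_leq_card subU)).
  have := leq_trans (hallS _) (leq_mul (leqnn c) (subset_leq_card subI)).
  have := cardsUI N1 N2; have := cardsUI F1 F2.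
  have := cardsD1 e (F1 :&: F2); rewrite inE e1 e2 /=.
  by move=> *; nia.
have nzS e : {x | x \in S e}.
  by apply/sigW/card_gt0P.
pose g e := sval (nzS e).
exists g; split=> [e|v]; first exact: svalP (nzS e).
apply: leq_trans (hallS _) _; rewrite -[leqRHS]muln1 leq_mul2l; apply/orP; right.
rewrite -[leqRHS](cards1 v); apply/subset_leq_card/bigcupsP => e; rewrite inE.
move=> /eqP gv; apply/subsetP => z zS; rewrite inE; apply/eqP.
rewrite -gv; apply: (card_le1_eqP (forallP small e)) => //.
exact: svalP (nzS e).
Qed.

(** * Koenig's edge colouring theorem *)

Lemma connect_pred (T : finType) (e : rel T) x y :
  connect e x y -> y = x \/ exists2 z, connect e x z & e z y.
Proof.
move=> /connectP[s]; case/lastP: s => [|s z] /=; first by left.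
rewrite rcons_path last_rcons => /andP[es ez] ->; right; exists (last x s) => //.
by apply/connectP; exists s.
Qed.

(** The uncoloured [e] is itself one of the at most [a] edges at [l e], so the others leave a colour
    free. *)
Lemma missing_colour (E A : finType) (a : nat) (l : E -> A) (F : {set E})
    (col : E -> 'I_a) e :
  e \notin F -> #|[set f | l f == l e]| <= a ->
  exists k, forall f, f \in F -> l f = l e -> col f != k.
Proof.
move=> eF le_a; pose K := [set f in F | l f == l e].
have ltK : #|col @: K| < #|'I_a|.
  rewrite card_ord; apply: leq_ltn_trans (leq_imset_card _ _) _.
  apply: leq_trans le_a; apply: proper_card; apply/properP; split.
    by apply/subsetP => f; rewrite !inE => /andP[].
  by exists e; rewrite !inE ?eqxx // (negPf eF).
have [k kK] : exists k, k \notin col @: K.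
  apply/existsP; rewrite -negb_forall; apply/negP => /forallP allK.
  by move: ltK; rewrite ltnNge subset_leq_card //; apply/subsetP => k _; apply: allK.
exists k => f fF fl; apply: contraNneq kK => <-; apply: imset_f.
by rewrite inE fF fl eqxx.
Qed.

Definition proper_on (E A : finType) (K : eqType) (F : {set E}) (l : E -> A)
    (col : E -> K) :=
  {in F &, forall f g, l f = l g -> col f = col g -> f = g}.

(* Kempe chains: from [l e] leave the left side along [be]-edges and the right
   side along [al]-edges; the vertices reached are closed under both kinds of
   edges since [l e] misses [al], and exclude [r e] since [r e] misses [be]. *)
Lemma colour_extend (E A B : finType) (a : nat) (l : E -> A) (r : E -> B)
    (F : {set E}) (col : E -> 'I_a) e :
  (forall x, #|[set f | l f == x]| <= a) ->
  (forall y, #|[set f | r f == y]| <= a) ->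
  proper_on F l col -> proper_on F r col -> e \notin F ->
  exists col' : E -> 'I_a,
    proper_on (e |: F) l col' /\ proper_on (e |: F) r col'.
Proof.
move=> la ra pl pr eF.
have [al alP] := missing_colour col eF (la (l e)).
have [be beP] := missing_colour col eF (ra (r e)).
pose step (u w : A + B) := match u, w with
  | inl u, inr w => [exists f in F, [&& col f == be, l f == u & r f == w]]
  | inr w, inl u => [exists f in F, [&& col f == al, l f == u & r f == w]]
  | _, _ => false end.
pose Z := connect step (inl (l e)).
have Zbe f : f \in F -> col f = be -> Z (inl (l f)) = Z (inr (r f)).
  move=> fF cf; apply/idP/idP => Zf.
    apply: connect_trans Zf (connect1 _); apply/existsP; exists f.
    by rewrite fF cf !eqxx.
  have [//|[[u|//] Zu /existsP[g /and4P[gF /eqP cg /eqP lg /eqP rg]]]] := connect_pred Zf.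
  by rewrite (pr f g) // ?cf // lg.
have Zal f : f \in F -> col f = al -> Z (inl (l f)) = Z (inr (r f)).
  move=> fF cf; apply/idP/idP => Zf.
    have [[lf]|[[//|w] Zw /existsP[g /and4P[gF /eqP cg /eqP lg /eqP rg]]]] := connect_pred Zf.
      by have := alP f fF lf; rewrite cf eqxx.
    by rewrite (pl f g) // ?cf // rg.
  apply: connect_trans Zf (connect1 _); apply/existsP; exists f.
  by rewrite fF cf !eqxx.
have ZNe : ~~ Z (inr (r e)).
  apply/negP => Zf.
  have [//|[[u|//] Zu /existsP[g /and4P[gF /eqP cg /eqP lg /eqP rg]]]] := connect_pred Zf.
  by have := beP g gF rg; rewrite cg eqxx.
(* Swapping [al] and [be] on [Z] frees [be] at [l e]; [r e] lies outside [Z] and still misses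
   [be]. *)
pose sw f := if Z (inl (l f)) then tperm al be (col f) else col f.
have swr f : f \in F -> sw f = if Z (inr (r f)) then tperm al be (col f) else col f.
  move=> fF; rewrite /sw; case: tpermP => [cf|cf|]; last by rewrite !if_same.
    by rewrite Zal.
  by rewrite Zbe.
pose col' f := if f == e then be else sw f.
have nF f : f \in F -> f == e = false.
  by move=> fF; apply: contraNF eF => /eqP <-.
exists col'; split=> f g; rewrite !inE /col'.
- have ne h : h \in F -> l h = l e -> sw h <> be.
    move=> hF lh; rewrite /sw lh /Z connect0 => /(congr1 (tperm al be)).
    by rewrite tpermK tpermR => ch; have := alP h hF lh; rewrite ch eqxx.
  have [->|_] /= := eqVneq f e; have [->|_] //= := eqVneq g e.
  + by move=> _ gF lg /esym/ne -[].
  + by move=> fF _ /ne H /H.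
  + move=> fF gF lfg; rewrite /sw lfg; case: ifP => _ cfg; apply: pl => //.
    exact: perm_inj cfg.
- have ne h : h \in F -> r h = r e -> sw h <> be.
    move=> hF rh; rewrite swr // rh (negPf ZNe) => ch.
    by have := beP h hF rh; rewrite ch eqxx.
  have [->|_] /= := eqVneq f e; have [->|_] //= := eqVneq g e.
  + by move=> _ gF rg /esym/ne -[].
  + by move=> fF _ /ne H /H.
  + move=> fF gF rfg; rewrite !swr // rfg; case: ifP => _ cfg; apply: pr => //.
    exact: perm_inj cfg.
Qed.

Lemma bipartite_edge_colouring (E A B : finType) (a : nat) (l : E -> A)
    (r : E -> B) : 0 < a ->
  (forall x, #|[set f | l f == x]| <= a) ->
  (forall y, #|[set f | r f == y]| <= a) ->
  exists col : E -> 'I_a, proper_on setT l col /\ proper_on setT r col.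
Proof.
move=> a_gt0 la ra.
suff: forall F : {set E}, exists col : E -> 'I_a,
    proper_on F l col /\ proper_on F r col by apply.
move=> F; have [m] := ubnP #|F|; elim: m F => // m IHm F.
rewrite ltnS => Fm; have [->|[e eF]] := set_0Vmem F.
  by exists (fun=> Ordinal a_gt0); split=> f g; rewrite inE.
have [|col [pl pr]] := IHm (F :\ e).
  by apply: leq_trans Fm; rewrite (cardsD1 e F) eF.
rewrite -(setD1K eF); apply: (colour_extend la ra pl pr).
by rewrite !inE eqxx.
Qed.

(** * Splitting a sparse graph into partial functions *)

Lemma edgesP (H : sgraph) (e : {set H}) :
  reflect (exists x y, sedge x y /\ e = [set x; y]) (e \in edges H).
Proof.
rewrite inE; apply: (iffP existsP) => [[x /existsP[y /andP[xy /eqP ->]]]|].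
  by exists x, y.
by move=> [x [y [xy ->]]]; exists x; apply/existsP; exists y; rewrite xy /=.
Qed.

(** The copies [c : E * 'I_b] are the edges of a bipartite multigraph joining the tail [g c] to
    [c.1]. Both degrees are at most [a], and each colour class becomes one partial function. *)
Lemma pseudoforest_decomposition (H : sgraph) (a b : nat) :
  0 < a -> b <= a ->
  (forall F : {set {set H}}, F \subset edges H -> b * #|F| <= a * #|cover F|) ->
  exists p : 'I_a -> H -> H,
    (forall i v, p i v = v \/ sedge v (p i v)) /\
    forall u v, sedge u v ->
      b <= #|[set i | (p i u == v) || (p i v == u)]|.
Proof.
move=> a_gt0 le_ba sparse.
pose E : finType := {e : {set H} | e \in edges H}.
have [|g [gE ga]] := @capacitated_hall (E * 'I_b)%type H a
    [ffun c => val c.1].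
  move=> F; pose F1 : {set {set H}} := [set val c.1 | c in F].
  have F1e : F1 \subset edges H.
    by apply/subsetP => _ /imsetP[c _ ->]; apply: valP.
  have -> : \bigcup_(c in F) [ffun c : E * 'I_b => val c.1] c = cover F1.
    by rewrite cover_imset; apply: eq_bigr => c _; rewrite ffunE.
  apply: leq_trans (sparse _ F1e); rewrite mulnC.
  have -> : #|F1| = #|[set c.1 | c in F]|.
    rewrite -(card_imset [set c.1 | c in F] val_inj) -imset_comp.
    by apply: eq_card => e; apply/imsetP/imsetP => -[c cF ->]; exists c.
  rewrite -[X in _ * X](card_ord b) -[X in _ * X]cardsT -cardsX; apply/subset_leq_card/subsetP.
  by move=> c cF; rewrite !inE andbT imset_f.
have rb (e : E) : #|[set c : E * 'I_b | c.1 == e]| <= a.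
  apply: leq_trans le_ba; rewrite -[leqRHS](card_ord b) -[leqRHS]cardsT.
  rewrite -[leqRHS]mul1n -[X in X * _](cards1 e) -cardsX; apply/subset_leq_card/subsetP => c.
  by rewrite !inE andbT.
have [col [pg pe]] := bipartite_edge_colouring a_gt0 ga rb.
pose other (e : {set H}) v := odflt v [pick w in e :\ v].
have otherE u v : u != v -> other [set u; v] u = v.
  move=> uv; rewrite /other; case: pickP => [w|/(_ v)] /=; rewrite !inE.
    by case/andP => /negPf -> /eqP.
  by rewrite eqxx orbT eq_sym uv.
(* The default [v] means that no copy of colour [i] leaves [v]. *)
pose p i v := odflt v [pick w | [exists c : E * 'I_b,
   [&& g c == v, col c == i & w == other (val c.1) v]]].
have pE c : p (col c) (g c) = other (val c.1) (g c).
  rewrite /p; case: pickP => [w /existsP[c' /and3P[/eqP gc /eqP cc /eqP ->]]|] /=.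
    by rewrite (pg c' c).
  by move=> /(_ (other (val c.1) (g c)))/existsPn/(_ c); rewrite !eqxx.
exists p; split=> [i v|u v uv].
  have otherP (e : {set H}) : e \in edges H -> v \in e -> sedge v (other e v).
    move=> /edgesP[x [y [xy ->]]].
    have ne : x != y by apply: contraTneq xy => ->; rewrite sedge_irrefl.
    rewrite !inE => /orP[/eqP ->|/eqP ->]; first by rewrite otherE.
    by rewrite setUC otherE 1?eq_sym // sedge_sym.
  rewrite /p; case: pickP => [w|_] /=; last by left.
  move=> /existsP[c /and3P[/eqP gc _ /eqP ->]]; right; apply: otherP.
    exact: valP c.1.
  by have := gE c; rewrite ffunE gc.
have eH : [set u; v] \in edges H by apply/edgesP; exists u, v.
have ne : u != v by apply: contraTneq uv => ->; rewrite sedge_irrefl.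
pose e : E := exist _ [set u; v] eH.
(* Copies of one edge have distinct colours, which yields [b] indices. *)
have inj : injective (fun k : 'I_b => col (e, k)).
  by move=> k k' ckk; have [] := pe (e, k) (e, k') (in_setT _) (in_setT _) erefl ckk.
rewrite -{1}(card_ord b) -(card_codom inj); apply/subset_leq_card/subsetP => _ /codomP[k ->].
have := gE (e, k); have := pE (e, k); rewrite ffunE /= => + /set2P[] gc.
  by rewrite gc otherE // => puv; rewrite inE puv eqxx.
by rewrite gc setUC otherE 1?eq_sym // => pvu; rewrite inE pvu eqxx orbT.
Qed.

(** The density is tested on the subgraph with edges [F] and vertices [cover F]. *)
Lemma density_edges (H : sgraph) (a b : nat) : 0 < b ->
  (density H <= a%:R / b%:R)%R ->
  forall F : {set {set H}}, F \subset edges H -> b * #|F| <= a * #|cover F|.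
Proof.
move=> b_gt0 dH F FE; have [->|[e eF]] := set_0Vmem F.
  by rewrite cards0 muln0.
have cov0 : cover F != set0.
  have /edgesP[x [y [_ exy]]] := subsetP FE e eF.
  by apply/set0Pn; exists x; apply/bigcupP; exists e => //; rewrite exy !inE eqxx.
have : (#|F|%:R / #|cover F|%:R <= a%:R / b%:R :> rat)%R.
  apply: le_trans dH; rewrite /density.
    rewrite (bigmaxD1 (cover F, F)) /=.
    by rewrite le_max lexx.
  rewrite cov0 /is_subgraph FE andbT; apply/forallP => f; apply/implyP => fF.
  exact: bigcup_sup fF.
rewrite ler_pdivrMr ?ltr0n ?card_gt0 //.
rewrite mulrAC ler_pdivlMr ?ltr0n //.
by rewrite -!natrM ler_nat [b * _]mulnC.
Qed.

(** * Labellings with small fibres *)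

(** Greedy choice: each chosen vertex discards at most [m] elements of [A]. *)
Lemma independent_seq (V : finType) (e : rel V) (m t : nat) (A : {set V}) :
  reflexive e -> (forall v, #|[set w | e v w]| <= m) -> t * m < #|A| ->
  exists s : seq V, [/\ size s = t.+1, {subset s <= A}
    & pairwise (fun v w => ~~ e v w) s].
Proof.
move=> e_refl em; elim: t A => [|t IHt] A ltA.
  have /card_gt0P[v vA] : 0 < #|A| by lia.
  by exists [:: v]; split=> // w; rewrite inE => /eqP ->.
have /card_gt0P[v vA] : 0 < #|A| by lia.
have [|s [sz sA sP]] := IHt (A :\: [set w | e v w]).
  have := em v; have := cardsID [set w | e v w] A.
  have := subset_leq_card (subsetIr A [set w | e v w]).
  by rewrite mulSn in ltA; lia.
exists (v :: s); split=> [|w|] /=.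
- by rewrite sz.
- rewrite inE => /predU1P[-> //|/sA].
  by rewrite inE => /andP[].
rewrite sP andbT; apply/allP => w /sA.
by rewrite !inE => /andP[].
Qed.

Lemma card_bigcup_le (I T : finType) (P : pred I) (F : I -> {set T}) :
  #|\bigcup_(i | P i) F i| <= \sum_(i | P i) #|F i|.
Proof.
elim/big_rec2: _ => [|i m A _ le_Am]; first by rewrite cards0.
by apply: leq_trans (leq_card_setU _ _) _; rewrite leq_add2l.
Qed.

(** Restriction to the complement of [A] is injective on [P], as every value on [A] is copied from
    outside [A]. *)
Lemma card_determined (T K : finType) (A : {set T}) (g : T -> T)
    (P : {set {ffun T -> K}}) :
  {in A, forall x, g x \notin A} ->
  {in P, forall r : {ffun T -> K}, {in A, forall x, r x = r (g x)}} ->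
  #|P| * #|K| ^ #|A| <= #|K| ^ #|T|.
Proof.
move=> gA gP; have [->|[r0 r0P]] := set_0Vmem P; first by rewrite cards0.
have [->|[x0 x0A]] := set_0Vmem A.
  by rewrite cards0 muln1 -card_ffun max_card.
pose k0 := r0 x0.
pose res (r : {ffun T -> K}) : {ffun T -> K} :=
  [ffun x => if x \in A then k0 else r x].
have resI : {in P &, injective res}.
  move=> r r' rP r'P /ffunP eqr.
  have eqN x : x \notin A -> r x = r' x.
    by move=> xA; have := eqr x; rewrite !ffunE (negPf xA).
  apply/ffunP => x; have [xA|/eqN//] := boolP (x \in A).
  by rewrite gP // [RHS]gP // eqN // gA.
rewrite -(card_in_imset resI).
have -> : #|T| = #|~: A| + #|A| by rewrite addnC cardsC.
rewrite expnD leq_mul2r; apply/orP; right.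
have <- : #|pffun_on k0 (mem (~: A)) (mem K)| = #|K| ^ #|~: A| by rewrite card_pffun_on.
apply/subset_leq_card/subsetP => _ /imsetP[r _ ->].
apply/pffun_onP; split; last by [].
by apply/subsetP => x; rewrite !inE ffunE; case: (x \in A) => //; rewrite eqxx.
Qed.

Definition overlap (V J T : finType) (supp : V -> J -> T) (v w : V) : bool :=
  [exists j, exists k, supp v j == supp w k].

(* First moment: if every labelling had a larger fibre, each would contain
   [t.+1] vertices with pairwise disjoint supports and equal image; a given
   such tuple occurs in a [q ^ (t * #|J|)]-th part of all labellings. *)
Lemma spread_labelling (V J T : finType) (q m t : nat) (supp : V -> J -> T) :
  0 < q -> 0 < #|J| ->
  (forall v, injective (supp v)) ->
  (forall v, #|[set w | overlap supp v w]| <= m) ->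
  #|V| ^ t.+1 < q ^ (t * #|J|) ->
  exists r : {ffun T -> 'I_q}, forall x : {ffun J -> 'I_q},
    #|[set v | [ffun j => r (supp v j)] == x]| <= t * m.
Proof.
move=> q_gt0 J_gt0 suppI overm ltq.
pose im (r : {ffun T -> 'I_q}) v := [ffun j => r (supp v j)].
suff /existsP[r /forallP rP] : [exists r : {ffun T -> 'I_q},
    [forall x : {ffun J -> 'I_q}, #|[set v | im r v == x]| <= t * m]].
  by exists r.
apply: contraT; rewrite negb_exists => /forallP bad.
pose tup := t.+1.-tuple V.
pose far : pred tup := fun s => pairwise (fun v w => ~~ overlap supp v w) s.
pose P (s : tup) := [set r | [forall i, im r (tnth s i) == im r (tnth s ord0)]].
(* A point of [J] makes [overlap] reflexive. *)
have [j0 _] : exists j0 : J, true by case/card_gt0P: J_gt0 => j0; exists j0.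
have cover : setT \subset \bigcup_(s | far s) P s.
  apply/subsetP => r _; have := bad r; rewrite negb_forall => /existsP[x].
  rewrite -ltnNge => /(independent_seq _ overm)[v|s [sz sx sP]].
    by apply/existsP; exists j0; apply/existsP; exists j0.
  apply/bigcupP; exists (Tuple (introT eqP sz)) => //.
  have imx i : im r (tnth (Tuple (introT eqP sz)) i) = x.
    by have := sx _ (mem_tnth i (Tuple (introT eqP sz))); rewrite inE => /eqP.
  by rewrite inE; apply/forallP => i; rewrite !imx.
have cardP s : far s -> #|P s| * q ^ (t * #|J|) <= q ^ #|T|.
  move=> far_s.
  have disj (i i' : 'I_t.+1) (j j' : J) : i < i' -> supp (tnth s i) j != supp (tnth s i') j'.
    move=> lt_ii'; have /pairwiseP := far_s.
    move=> /(_ (tnth s ord0) i i'); rewrite !inE !size_tuple !ltn_ord.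
    move=> /(_ isT isT lt_ii'); rewrite -!tnth_nth; apply: contra => eqs.
    by apply/existsP; exists j; apply/existsP; exists j'.
  (* [phi] lists the labels in the supports of the later entries; [g] sends each to its counterpart
     in the first entry, whose value it must share under any labelling in [P s]. *)
  pose phi (c : 'I_t * J) := supp (tnth s (lift ord0 c.1)) c.2.
  have phiI : injective phi.
    move=> [k j] [k' j']; rewrite /phi /= => eq_phi.
    have [ltk|ltk|/val_inj eqk] := ltngtP k k'.
    - by have /eqP[] := disj (lift ord0 k) (lift ord0 k') j j' ltk.
    - by have /eqP[] := disj (lift ord0 k') (lift ord0 k) j' j ltk.
    - by rewrite eqk in eq_phi *; rewrite (suppI _ _ _ eq_phi).
  pose g x := if [pick c | phi c == x] is Some c then supp (tnth s ord0) c.2 else x.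
  have gphi c : g (phi c) = supp (tnth s ord0) c.2.
    rewrite /g; case: pickP => [c' /eqP/phiI -> //|/(_ c)].
    by rewrite eqxx.
  have <- : #|phi @: setT| = t * #|J|.
    by rewrite card_imset // cardsT card_prod card_ord.
  have := @card_determined T 'I_q (phi @: setT) g (P s).
  rewrite !card_ord; apply.
    move=> _ /imsetP[c _ ->]; rewrite gphi; apply/imsetP => -[c' _] /eqP.
    by apply/negP; apply: disj.
  move=> r; rewrite inE => /forallP rP _ /imsetP[c _ ->]; rewrite gphi.
  by have /eqP/ffunP/(_ c.2) := rP (lift ord0 c.1); rewrite !ffunE.
have : q ^ #|T| * q ^ (t * #|J|) <= #|V| ^ t.+1 * q ^ #|T|.
  rewrite -card_tuple -{1}(card_ord q) -card_ffun -[X in X * _]cardsT.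
  apply: leq_trans (leq_mul (subset_leq_card cover) (leqnn _)) _.
  apply: leq_trans (leq_mul (card_bigcup_le _ _) (leqnn _)) _.
  rewrite big_distrl /=; apply: leq_trans (leq_sum _ cardP) _.
  by rewrite sum_nat_const leq_mul2r max_card orbT.
by rewrite mulnC leq_mul2r expn_eq0 -leqn0 leqNgt q_gt0 /= leqNgt ltq.
Qed.

(** * Ancestor sequences with contracted short cycles *)

Section Ancestors.

Variables (V : finType) (p : V -> V) (L : nat).

(* [p u = u] encodes that [u] has no parent, so roots count as short cycles. *)
Definition terminal (u : V) : bool := [exists c : 'I_L, iter c.+1 p u == u].

(** The [pick] sees only the set reachable from [u], so all vertices of a short cycle get one
    representative. *)
Definition cycle_repr (u : V) : V :=
  if terminal u then odflt u [pick w | fconnect p u w] else u.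

(* A terminal vertex is continued by the fictitious ancestors [(u, k)]. *)
Definition ancestor_step (y : V * nat) : V * nat :=
  if (y.2 == 0) && ~~ terminal y.1 then (cycle_repr (p y.1), 0) else (y.1, y.2.+1).

Definition ancestor (v : V) (j : nat) : V * nat :=
  iter j ancestor_step (cycle_repr v, 0).

Lemma terminal_iter k u : terminal u -> terminal (iter k p u).
Proof.
move=> /existsP[c /eqP pu]; apply/existsP; exists c.
by rewrite -iterD addnC iterD pu.
Qed.

(** The number of steps to the representative is reduced modulo a period of length at most [L]. *)
Lemma cycle_repr_iter u : exists2 k, k <= L & cycle_repr u = iter k p u.
Proof.
rewrite /cycle_repr; case: ifP => [/existsP[c /eqP pu]|_]; last by exists 0.
case: pickP => [w /= uw|_]; last by exists 0.
exists (findex p u w %% c.+1); last first.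
  rewrite -{1}(iter_findex uw) {1}(divn_eq (findex p u w) c.+1) addnC iterD.
  by congr (iter _ _ _); rewrite iterM; apply: iter_fix.
by apply: leq_trans (ltn_ord c); apply: ltnW; rewrite ltn_mod.
Qed.

Lemma terminal_cycle_repr u : terminal (cycle_repr u) = terminal u.
Proof.
case tu: (terminal u); last by rewrite /cycle_repr tu.
by have [k _ ->] := cycle_repr_iter u; apply: terminal_iter.
Qed.

Lemma cycle_repr_nonterminal u : ~~ terminal u -> cycle_repr u = u.
Proof. by rewrite /cycle_repr => /negPf ->. Qed.

Lemma cycle_repr_terminal u : terminal u -> cycle_repr (p u) = cycle_repr u.
Proof.
move=> tu; rewrite /cycle_repr tu (terminal_iter 1 tu).
have eqc : fconnect p (p u) =1 fconnect p u.
  have [c /eqP pu] := existsP tu.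
  have cu : fconnect p (p u) u by rewrite -{2}pu iterSr fconnect_iter.
  move=> w; apply/idP/idP; first exact/connect_trans/fconnect1.
  exact: connect_trans.
rewrite (eq_pick eqc); case: pickP => // /(_ u).
by rewrite /= connect0.
Qed.

(** On a short cycle, child and parent have the same representative; elsewhere the parent is simply
    the next ancestor. Words of adjacent vertices will hence be equal or shifted. *)
Lemma ancestor_parent v :
  (forall j, ancestor (p v) j = ancestor v j) \/
  (forall j, ancestor (p v) j = ancestor v j.+1).
Proof.
have [tv | tv] := boolP (terminal v); [left | right]; move=> j.
  by rewrite /ancestor cycle_repr_terminal.
rewrite /ancestor iterSr /ancestor_step /= terminal_cycle_repr tv.
by rewrite (cycle_repr_nonterminal tv).
Qed.

Lemma ancestor_level v j : (ancestor v j).2 <= j.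
Proof.
elim: j => //= j IHj; rewrite /ancestor_step.
by case: ifP.
Qed.

(** At most one jump to a representative, of at most [L] steps, is made: a terminal vertex no longer
    moves. *)
Lemma ancestor_near v j :
  exists2 k, k <= j + L & (ancestor v j).1 = iter k p v.
Proof.
suff [k kP ->] : exists2 k, k <= j + (if terminal (ancestor v j).1 then L else 0) &
    (ancestor v j).1 = iter k p v.
  by exists k => //; apply: leq_trans kP _; case: ifP => _; rewrite ?addn0 ?leq_addr.
elim: j => [|j [k kj IHj]].
  rewrite /ancestor /= terminal_cycle_repr; case: ifP => tv; first exact: cycle_repr_iter.
  by exists 0; rewrite // cycle_repr_nonterminal ?tv.
rewrite -[ancestor v j.+1]/(ancestor_step (ancestor v j)) /ancestor_step.
have [/andP[_ nt]|_] /= :=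
  boolP (((ancestor v j).2 == 0) && ~~ terminal (ancestor v j).1); last first.
  by exists k => //; rewrite addSn ltnW.
rewrite terminal_cycle_repr; rewrite (negPf nt) addn0 in kj.
case: ifP => tv.
  have [c cL ->] := cycle_repr_iter (p (ancestor v j).1).
  by exists (c + k.+1); [lia | rewrite iterD iterS -IHj].
by exists k.+1; [lia | rewrite cycle_repr_nonterminal ?tv // IHj].
Qed.

(** Fictitious ancestors have growing level and never return. Otherwise the walk follows [p], and a
    return within [L] steps would make its start terminal. *)
Lemma ancestor_step_cycle y c : c < L -> iter c.+1 ancestor_step y <> y.
Proof.
case: y => u k ltcL.
have stay j w : (0 < k) || terminal w -> iter j ancestor_step (w, k) = (w, k + j).
  move=> h; elim: j => [|j IHj]; first by rewrite addn0.
  rewrite iterS IHj /ancestor_step /= addnS.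
  by case: ifP => // /andP[]; move: h; case: (terminal w) => //; lia.
have [h|] := boolP ((0 < k) || terminal u).
  by rewrite stay // => -[]; lia.
rewrite negb_or -eqn0Ngt => /andP[/eqP k0 nt]; subst k.
have walk j : let y := iter j ancestor_step (u, 0) in
    terminal y.1 \/ y = (iter j p u, 0).
  elim: j => [|j] /=; first by right.
  case=> [ty|->]; first by left; rewrite {1}/ancestor_step ty andbF.
  rewrite /ancestor_step /=.
  have [t|t] := boolP (terminal (iter j p u)); first by left.
  have [t'|t'] := boolP (terminal (p (iter j p u))).
    by left; rewrite terminal_cycle_repr.
  by right; rewrite cycle_repr_nonterminal.
move=> cyc; case: (walk c.+1); rewrite cyc /=; first by apply/negP.
case=> pu; case/negP: nt; apply/existsP; exists (Ordinal ltcL).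
by rewrite /= -pu.
Qed.

Lemma ancestor_inj v j k : j < L -> k < L -> ancestor v j = ancestor v k -> j = k.
Proof.
wlog: j k / j <= k => [W|le_jk] jL kL eqa.
  have [le_jk|/ltnW le_kj] := leqP j k; first exact: W.
  by symmetry; apply: W.
move: eqa; have [//|ne] := eqVneq j k; rewrite /ancestor.
have -> : k = (k - j).-1.+1 + j by lia.
rewrite iterD => /esym/ancestor_step_cycle[].
by lia.
Qed.

End Ancestors.

(** * Balls in graphs of bounded degree *)

Section Ball.

Variable H : sgraph.

Fixpoint gball (k : nat) (v : H) : {set H} :=
  if k is k'.+1 then \bigcup_(u in gball k' v) (u |: [set w | sedge u w])
  else [set v].

Lemma card_gball D k v : max_degree H <= D -> #|gball k v| <= D.+1 ^ k.
Proof.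
move=> degH; elim: k => [|k IHk] /=; first by rewrite cards1.
apply: leq_trans (card_bigcup_le _ _) _.
apply: (@leq_trans (\sum_(u in gball k v) D.+1)).
  apply: leq_sum => u _; apply: leq_trans (leq_card_setU _ _) _.
  rewrite cards1 add1n ltnS; apply: leq_trans degH.
  exact: (leq_bigmax (F := @degree H)).
by rewrite sum_nat_const expnS mulnC leq_mul2l IHk.
Qed.

Lemma gballD k m u v w : v \in gball k u -> w \in gball m v -> w \in gball (m + k) u.
Proof.
move=> vu; elim: m w => [|m IHm] w /=; first by rewrite inE => /eqP ->.
move=> /bigcupP[x /IHm xu wx]; apply/bigcupP; by exists x.
Qed.

Lemma gball_step u v : v = u \/ sedge u v -> v \in gball 1 u.
Proof.
by move=> uv; rewrite /= big_set1 !inE; case: uv => ->; rewrite ?eqxx ?orbT.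
Qed.

Lemma gball_mono k m v : k <= m -> gball k v \subset gball m v.
Proof.
move=> /subnKC <-; elim: (m - k) => [|j IHj]; first by rewrite addn0.
apply: subset_trans IHj _; rewrite addnS /=; apply/subsetP => w wv.
by apply/bigcupP; exists w => //; rewrite setU11.
Qed.

(** Both directions serve to pass from a vertex up to a common ancestor and down to another
    vertex. *)
Lemma gball_iter (p : H -> H) k v :
  (forall u, p u = u \/ sedge u (p u)) ->
  (iter k p v \in gball k v) && (v \in gball k (iter k p v)).
Proof.
move=> pP; elim: k => [|k /andP[IH1 IH2]]; first by rewrite /= inE eqxx.
apply/andP; split.
  by rewrite -{2}[k.+1]add1n; apply: (gballD IH1); apply: gball_step; apply: pP.
rewrite iterS -[k.+1]addn1; apply: gballD IH2; apply: gball_step.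
by case: (pP (iter k p v)) => [->|]; [left | right; rewrite sedge_sym].
Qed.

End Ball.

(** * Words and the host graph *)

(** The arc relation of the de Bruijn graph on words of length [L]. *)
Definition shifted (L q : nat) (x y : {ffun 'I_L -> 'I_q}) : bool :=
  [forall j : 'I_L, forall k : 'I_L, (k == j.+1 :> nat) ==> (x k == y j)].

Definition near_words (L q : nat) (x y : {ffun 'I_L -> 'I_q}) : bool :=
  [|| x == y, shifted x y | shifted y x].

(** A shift of [x] is determined up to its last letter, or its first in the opposite direction. *)
Lemma card_near_words (L q : nat) (x : {ffun 'I_L.+1 -> 'I_q}) :
  #|[set y | near_words x y]| <= 1 + q + q.
Proof.
have inj (j0 : 'I_L.+1) (P : pred {ffun 'I_L.+1 -> 'I_q}) :
    {in P &, forall y z : {ffun 'I_L.+1 -> 'I_q}, y j0 = z j0 -> y = z} ->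
    #|[set y | P y]| <= q.
  move=> Pinj; rewrite -[leqRHS](card_ord q).
  rewrite -(card_in_imset (f := fun y : {ffun 'I_L.+1 -> 'I_q} => y j0)) ?max_card //.
  by move=> y z; rewrite !inE; apply: Pinj.
have -> : [set y | near_words x y] =
    [set x] :|: [set y | shifted x y] :|: [set y | shifted y x].
  by apply/setP => y; rewrite !inE /near_words [x == y]eq_sym orbA.
apply: leq_trans (leq_card_setU _ _) (leq_add _ _); last first.
  apply: (inj ord0) => y z /forallP yx /forallP zx yz; apply/ffunP => k.
  have [k0|k_gt0] := posnP k; first by rewrite (_ : k = ord0) //; apply: val_inj.
  have kL : k.-1 < L.+1 by apply: leq_ltn_trans (leq_pred _) (ltn_ord k).
  have := forallP (zx (Ordinal kL)) k; have := forallP (yx (Ordinal kL)) k.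
  by rewrite /= prednK // eqxx => /eqP -> /eqP ->.
apply: leq_trans (leq_card_setU _ _) _; rewrite cards1 leq_add2l.
apply: (inj ord_max) => y z /forallP yx /forallP zx yz; apply/ffunP => j.
have [jL|jL] := ltnP j L; last first.
  rewrite (_ : j = ord_max) //; apply: val_inj => /=; apply/eqP.
  by rewrite eqn_leq jL -ltnS ltn_ord.
have := forallP (zx j) (Ordinal (jL : j.+1 < L.+1)).
have := forallP (yx j) (Ordinal (jL : j.+1 < L.+1)).
by rewrite /= eqxx => /eqP <- /eqP <-.
Qed.

(* Words have length [L.+1]; the factor ['I_B] is the blow-up that separates the
   vertices of a fibre. *)
Section Host.

Variables (a b L q B : nat).

Definition host_vertex : finType :=
  ({ffun 'I_a -> {ffun 'I_L.+1 -> 'I_q}} * 'I_B)%type.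

Definition host_edge : rel host_vertex := fun x y =>
  (x != y) && (b <= #|[set i | near_words (x.1 i) (y.1 i)]|).

Lemma near_words_sym : symmetric (@near_words L.+1 q).
Proof. by move=> x y; rewrite /near_words eq_sym [shifted x y || _]orbC. Qed.

Lemma host_edge_sym : symmetric host_edge.
Proof.
move=> x y; rewrite /host_edge eq_sym; congr (_ && (_ <= _)).
by apply: eq_card => i; rewrite !inE near_words_sym.
Qed.

Lemma host_edge_irrefl : irreflexive host_edge.
Proof. by move=> x; rewrite /host_edge eqxx. Qed.

Definition host : sgraph := SGraph host_edge_sym host_edge_irrefl.

(** Union bound over the sets [S] of [b] near coordinates: those in [S] have at most [1 + q + q]
    choices, the others are free. *)
Lemma degree_host (x : host) : b <= a -> 0 < q ->
  degree x <= 2 ^ a * ((1 + q + q) ^ b * (q ^ L.+1) ^ (a - b)) * B.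
Proof.
move=> le_ba q_gt0.
pose F (S : {set 'I_a}) i : {set {ffun 'I_L.+1 -> 'I_q}} :=
  if i \in S then [set y | near_words (x.1 i) y] else setT.
pose N (S : {set 'I_a}) : {set host} :=
  setX [set y | y \in family (fun i => mem (F S i))] setT.
have cardN (S : {set 'I_a}) : #|S| = b -> #|N S| <= (1 + q + q) ^ b * (q ^ L.+1) ^ (a - b) * B.
  move=> Sb; rewrite cardsX cardsT card_ord leq_mul2r; apply/orP; right.
  rewrite cardsE card_family foldrE big_map big_enum /=.
  rewrite (bigID (mem S)) /=; apply: leq_mul.
    rewrite -Sb -prod_nat_const; apply: leq_prod => i iS.
    by rewrite /F iS; apply: card_near_words.
  have -> : a - b = #|~: S| by rewrite cardsCs setCK card_ord Sb.
  rewrite -prod_nat_const [leqRHS](eq_bigl (fun i => i \notin S)); last first.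
    by move=> i; rewrite !inE.
  apply: leq_prod => i; rewrite /F => /negPf ->.
  by rewrite cardsT card_ffun !card_ord.
have sub : [set y | sedge x y] \subset \bigcup_(S : {set 'I_a} | #|S| == b) N S.
  apply/subsetP => y; rewrite inE => /andP[_ le_b].
  have [S [SN Sb]] : exists S : {set 'I_a},
      S \subset [set i | near_words (x.1 i) (y.1 i)] /\ #|S| == b.
    have [S] := card_geqP le_b.
    move=> [uS sS SN]; exists [set i in S]; split.
      by apply/subsetP => i; rewrite inE => /SN.
    by rewrite cardsE (card_uniqP uS) sS.
  apply/bigcupP; exists S => //; rewrite !inE andbT; apply/familyP => i.
  rewrite /F; case: ifP => // iS; have := subsetP SN i iS.
  by rewrite !inE.
rewrite /degree; apply: leq_trans (subset_leq_card sub) _.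
apply: leq_trans (card_bigcup_le _ _) _.
apply: leq_trans (leq_sum _ (fun S h => cardN S (eqP h))) _.
rewrite sum_nat_const mulnA !leq_mul2r; do 2!(apply/orP; right).
by apply: leq_trans (max_card _) _; rewrite -cardsT -powersetT card_powerset cardsT card_ord.
Qed.

Lemma card_edges_le (G : sgraph) (m : nat) :
  (forall x : G, degree x <= m) -> #|edges G| <= #|G| * m.
Proof.
move=> degG.
have sub : edges G \subset \bigcup_(x : G) [set [set x; y] | y in [set y | sedge x y]].
  apply/subsetP => e /edgesP[x [y [xy ->]]]; apply/bigcupP; exists x => //.
  by apply: imset_f; rewrite inE.
apply: leq_trans (subset_leq_card sub) _; apply: leq_trans (card_bigcup_le _ _) _.
rewrite -sum_nat_const; apply: leq_sum => x _.
exact: leq_trans (leq_imset_card _ _) (degG x).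
Qed.

End Host.

(** * Embedding into the host *)

(** Each vertex takes its position in its fibre, which becomes the blow-up coordinate. *)
Lemma fibre_index (V X : finType) (f : V -> X) (B : nat) :
  (forall x, #|[set v | f v == x]| <= B) ->
  exists k : V -> 'I_B, forall u v, f u = f v -> k u = k v -> u = v.
Proof.
move=> fB; pose F v := enum [set w | f w == f v].
have ltB v : index v (F v) < B.
  apply: leq_trans (fB (f v)); rewrite [ltnRHS]cardE index_mem.
  by rewrite mem_enum inE eqxx.
exists (fun v => Ordinal (ltB v)) => u v fuv [] eq_idx.
have Fuv : F u = F v by rewrite /F fuv.
have uF : u \in F v by rewrite mem_enum inE fuv eqxx.
have vF : v \in F v by rewrite mem_enum inE eqxx.
by have := nth_index v uF; rewrite -{2}Fuv eq_idx nth_index.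
Qed.

(** The fibre bound [t * m] of [spread_labelling] with [t = L.+2] and [m] bounding a ball of radius
    [4 * L.+1]. *)
Definition multiplicity (D L : nat) : nat := L.+2 * D.+1 ^ (4 * L.+1).

Lemma host_universal (a b D L : nat) (H : sgraph) :
  0 < a -> b <= a -> #|H| <= 2 ^ (a * L.+1 ^ 2) -> max_degree H <= D ->
  (forall F : {set {set H}}, F \subset edges H -> b * #|F| <= a * #|cover F|) ->
  contained_in H (host a b L (2 ^ L.+2) (multiplicity D L)).
Proof.
move=> a_gt0 le_ba leH degH /(pseudoforest_decomposition a_gt0 le_ba) [p [pP pE]].
set q := 2 ^ L.+2.
(* The level is at most [j], so [inord] loses nothing; the tag [c.1] in [supp] separates the
   colours. *)
pose label i v j : H * 'I_L.+1 :=
  let y := ancestor (p i) L.+1 v j in (y.1, inord y.2).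
pose supp v (c : 'I_a * 'I_L.+1) := (c.1, label c.1 v c.2).
have suppI v : injective (supp v).
  move=> [i j] [i' j'] [/= <- eq1 eq2]; congr pair; apply: val_inj.
  apply: (ancestor_inj (ltn_ord j) (ltn_ord j')).
  have lt2 k : k < L.+1 -> (ancestor (p i) L.+1 v k).2 < L.+1.
    by apply: leq_ltn_trans; apply: ancestor_level.
  apply: injective_projections; first exact: eq1.
  by rewrite -(inordK (lt2 _ (ltn_ord j))) eq2 inordK // lt2.
have overB v : #|[set w | overlap supp v w]| <= D.+1 ^ (4 * L.+1).
  apply: leq_trans (card_gball _ v degH); apply/subset_leq_card/subsetP => w.
  rewrite inE => /existsP[[i j] /existsP[[i' j'] /eqP[/= <- eqa _]]].
  have [k kj vk] := ancestor_near (p i) L.+1 v j.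
  have [k' kj' wk] := ancestor_near (p i) L.+1 w j'.
  have /andP[b1 _] := gball_iter k v (pP i).
  have /andP[_ b2] := gball_iter k' w (pP i).
  rewrite -vk eqa in b1; rewrite -wk in b2.
  (* Both indices are at most [L] and both jumps at most [L.+1]. *)
  have le4 : k' + k <= 4 * L.+1.
    by have := ltn_ord j; have := ltn_ord j'; lia.
  exact: (subsetP (gball_mono v le4) w (gballD b1 b2)).
have [|||r rP] := @spread_labelling _ _ _ q _ L.+2 supp _ _ suppI overB.
- by rewrite expn_gt0.
- by rewrite card_prod !card_ord muln_gt0 a_gt0.
(* This reduces to [(L + 1) * (L + 3) < (L + 2) ^ 2], whence the choice [t = L.+2] and
   [q = 2 ^ L.+2]. *)
- rewrite card_prod !card_ord; 
  apply: (@leq_ltn_trans ((2 ^ (a * L.+1 ^ 2)) ^ L.+3)); first by rewrite leq_exp2r.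
  by rewrite -!expnM ltn_exp2l //; nia.
pose word v i := [ffun j => r (supp v (i, j))].
have [k kP] := fibre_index (f := fun v => [ffun c => r (supp v c)]) rP.
exists (fun v => ([ffun i => word v i], k v)) => [u v [/ffunP eqw]|u v uv].
  apply: kP; apply/ffunP => -[i j].
  by have := eqw i; rewrite !ffunE => /ffunP/(_ j); rewrite !ffunE.
have near i u' v' : p i u' = v' -> near_words (word u' i) (word v' i).
  move=> <-; rewrite /near_words.
  have [eqa|eqa] := ancestor_parent (p i) L.+1 u'.
    apply/orP; left; apply/eqP/ffunP => j.
    by rewrite !ffunE /supp /label /= eqa.
  apply/or3P; apply: Or32; apply/forallP => j; apply/forallP => j'.
  by apply/implyP => /eqP jj'; rewrite !ffunE /supp /label /= eqa jj'.
apply/andP; split.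
  apply: contraTneq uv => -[/ffunP eqw /kP eqk].
  rewrite eqk ?sedge_irrefl //; apply/ffunP => -[i j].
  by have := eqw i; rewrite !ffunE => /ffunP/(_ j); rewrite !ffunE.
apply: leq_trans (pE u v uv) _; apply/subset_leq_card/subsetP => i.
rewrite !inE !ffunE => /orP[] /eqP /near //.
by rewrite near_words_sym.
Qed.

(** * Edge count and real estimates *)

(** In order: two blow-up factors, the choice of [S], the near words, and the excess of
    [(L + 1) * (L + 2)] over [L ^ 2], which is at most [3 * L.+1]. *)
Definition loss (a b D : nat) : nat := 2 * (1 + 4 * D) + a + 4 * b + 3 * (2 * a - b).

Lemma card_edges_host (a b D L : nat) : b <= a ->
  #|edges (host a b L (2 ^ L.+2) (multiplicity D L))|
    <= 2 ^ ((2 * a - b) * L ^ 2 + loss a b D * L.+1).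
Proof.
move=> le_ba; set q := 2 ^ L.+2; set B := multiplicity D L.
have q_gt0 : 0 < q by rewrite expn_gt0.
apply: leq_trans (card_edges_le (fun x => @degree_host a b L q B x le_ba q_gt0)) _.
rewrite card_prod card_ffun card_ffun !card_ord.
have leB : B <= 2 ^ ((1 + 4 * D) * L.+1).
  rewrite mulnDl expnD mul1n; apply: leq_mul; first exact: ltn_expl.
  rewrite [4 * D]mulnC -mulnA [2 ^ _]expnM leq_exp2r //; exact: ltn_expl.
have leq3 : 1 + q + q <= 2 ^ (4 * L.+1).
  apply: (@leq_trans (2 ^ L.+4)); last by rewrite leq_exp2l //; lia.
  by rewrite !expnS -/q; move: q_gt0; rewrite /q !expnS; lia.
have le1 : (1 + q + q) ^ b <= 2 ^ (4 * L.+1 * b).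
  by rewrite expnM; case: (b) => // b'; rewrite leq_exp2r.
have -> : q ^ L.+1 = 2 ^ (L.+2 * L.+1) by rewrite expnM.
apply: (@leq_trans (2 ^ (L.+2 * L.+1 * a) * 2 ^ ((1 + 4 * D) * L.+1) *
   (2 ^ a * (2 ^ (4 * L.+1 * b) * 2 ^ (L.+2 * L.+1 * (a - b)))
     * 2 ^ ((1 + 4 * D) * L.+1)))).
  by rewrite -!expnM; do ?apply: leq_mul => //.
rewrite -!expnD leq_exp2l // /loss.
have [c ->] : exists c, a = b + c by exists (a - b); rewrite subnKC.
have -> : 2 * (b + c) - b = b + 2 * c by lia.
have -> : b + c - b = c by lia.
by nia.
Qed.

Local Open Scope ring_scope.

Lemma small_graph_universal (F : sgraph -> Prop) (n : nat) :
  (n <= 1)%N -> (forall H, F H -> #|H| = n) ->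
  exists G : sgraph, #|edges G| = 0%N /\ universal F G.
Proof.
move=> n1 Fn.
have irr : irreflexive (fun _ _ : unit => false) by [].
have sym : symmetric (fun _ _ : unit => false) by [].
exists (SGraph sym irr); split.
  apply/eqP; rewrite cards_eq0; apply/eqP/setP => e; rewrite !inE.
  by apply/existsP => -[x /existsP[y]].
move=> H /Fn Hn; have sub (x y : H) : x = y.
  have le1 : (#|H| <= 1)%N by rewrite Hn.
  exact: (fintype_le1P le1).
by exists (fun=> tt) => [x y _|x y]; rewrite (sub x y) ?sedge_irrefl.
Qed.

(** Minimality of the word length [L.+1] gives the lower bound on [n] needed to count edges. *)
Lemma word_length (a n : nat) : (0 < a)%N -> (1 < n)%N ->
  exists L, (n <= 2 ^ (a * L.+1 ^ 2))%N /\ (2 ^ (a * L ^ 2) < n)%N.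
Proof.
move=> a_gt0 n_gt1.
have ex : exists l, (n <= 2 ^ (a * l ^ 2))%N.
  by exists n; apply: leq_trans (ltnW (ltn_expl n (isT : (1 < 2)%N))) _;
    rewrite leq_exp2l //; nia.
have [[|L] nL minL] := ex_minnP ex.
  by move: nL; rewrite muln0 leqNgt n_gt1.
exists L; split=> //; rewrite ltnNge; apply/negP => /minL.
by rewrite ltnn.
Qed.

(** The exponents match because [2 * a - b = a * (2 - b / a)]. *)
Lemma main_factor (R : realType) (a b L n : nat) : (b <= a)%N -> (0 < a)%N ->
  (2 ^ (a * L ^ 2) < n)%N ->
  ((2 ^ ((2 * a - b) * L ^ 2))%:R <= n%:R `^ (2 - b%:R / a%:R) :> R).
Proof.
move=> le_ba a_gt0 ltn.
have a0 : a%:R != 0 :> R by rewrite pnatr_eq0 -lt0n.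
have -> : (2 ^ ((2 * a - b) * L ^ 2))%:R =
    ((2 ^ (a * L ^ 2))%:R : R) `^ (2 - b%:R / a%:R).
  rewrite !natrX -!powR_mulrn // -powRrM; congr (_ `^ _).
  rewrite !natrM natrB; last by lia.
  by rewrite !natrM; field.
apply: ge0_ler_powR; rewrite ?nnegrE ?ler0n //; last by rewrite ler_nat ltnW.
rewrite subr_ge0 ler_pdivrMr ?ltr0n //.
by rewrite -natrM ler_nat; lia.
Qed.

(** Both [L * sqrt (ln 2)] and [sqrt (ln 2)] are at most [sqrt (ln n)]; their sum gives the factor
    2. *)
Lemma error_factor (R : realType) (a K L n : nat) : (0 < a)%N -> (1 < n)%N ->
  (2 ^ (a * L ^ 2) < n)%N ->
  ((2 ^ (K * L.+1))%:R
    <= 2 `^ (2 * K%:R / Num.sqrt (ln 2) * Num.sqrt (ln n%:R)) :> R).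
Proof.
move=> a_gt0 n_gt1 ltn.
have ln2_gt0 : 0 < ln 2 :> R by apply: ln_gt0; rewrite ltr1n.
have s2_gt0 : 0 < Num.sqrt (ln 2) :> R by rewrite sqrtr_gt0.
set s2 := Num.sqrt _ in s2_gt0 *; set sn := Num.sqrt _.
have le1 : s2 <= sn.
  by rewrite ler_wsqrtr // ler_ln ?posrE ?ltr0n ?ler_nat //; lia.
have leL : L%:R * s2 <= sn.
  have -> : L%:R * s2 = Num.sqrt (L%:R ^+ 2 * ln 2).
    by rewrite sqrtrM ?sqr_ge0 // sqrtr_sqr ger0_norm.
  rewrite ler_wsqrtr // -natrX mulr_natl -lnXn // ler_ln ?posrE ?exprn_gt0 ?ltr0n //.
    rewrite -natrX ler_nat; apply: leq_trans (ltnW ltn).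
    by rewrite leq_exp2l // leq_pmull.
  by lia.
rewrite natrX -powR_mulrn //; apply: ler_powR; first by rewrite ler1n.
rewrite natrM mulrAC ler_pdivlMr // -mulrA [2 * _]mulrC -!mulrA ler_wpM2l //.
by rewrite -natr1; lra.
Qed.

Theorem theorem1p4 (R : realType) (D : nat) (d : rat) (hd : 1 < d) :
  exists C : R, forall n : nat, exists G : sgraph,
    (#|edges G|%:R <= n%:R `^ (2 - 1 / ratr d)
                      * 2 `^ (C * Num.sqrt (ln (n%:R : R))) :> R)
    /\ universal (bounded_density_family D d n) G.
Proof.
pose a := `|numq d|%N; pose b := `|denq d|%N.
have b_gt0 : (0 < b)%N by rewrite absz_gt0 denq_neq0.
have numE : numq d = a :> int.
  by rewrite gez0_abs // ltW // numq_gt0 (lt_trans _ hd).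
have dE : d = a%:R / b%:R :> rat.
  by rewrite -{1}(divq_num_den d) numE -absz_denq.
have le_ba : (b <= a)%N.
  have := hd; rewrite dE ltr_pdivlMr ?ltr0n // mul1r ltr_nat.
  exact: ltnW.
have a_gt0 : (0 < a)%N by apply: leq_trans le_ba.
exists (2 * (loss a b D)%:R / Num.sqrt (ln 2)) => n.
(* A positive word length and [ln 2 <= ln n] both require [1 < n]. *)
have [n1|n_gt1] := leqP n 1.
  have [H []//|G [G0 GU]] := @small_graph_universal (bounded_density_family D d n) n n1.
    by case.
  by exists G; split=> //; rewrite G0 mulr_ge0 ?powR_ge0.
have [L [le_n lt_n]] := word_length a_gt0 n_gt1.
exists (host a b L (2 ^ L.+2) (multiplicity D L)); split.
  have -> : 1 / ratr d = b%:R / a%:R :> R.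
    by rewrite div1r dE fmorph_div /= !ratr_nat invf_div.
  apply: le_trans (_ : (2 ^ ((2 * a - b) * L ^ 2 + loss a b D * L.+1))%:R <= _).
    by rewrite ler_nat card_edges_host.
  rewrite expnD natrM; apply: ler_pM; rewrite ?ler0n //.
    exact: main_factor.
  exact: (error_factor _ _ a_gt0).
move=> H [[Hn dH] degH]; apply: host_universal => //; first by rewrite Hn.
by apply: density_edges; rewrite -?dE.
Qed.
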